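(* Consider the cooperative cost game $(C,\nu)$ whose players are the edges $C$ of the complete graph on $N$, where for each coalition of edges $\Lambda\subseteq C$ the value $\nu(\Lambda)$ is the best upper bound on the output energy that can be certified via quadratic Lyapunov functions of the multi-agent control scheme induced by $(N,\Lambda)$ (see the context). Then $(C,\nu)$ is a monotonic TU conic game. Furthermore, for every $\Lambda\subseteq C$ the characteristic function can be represented by the following semidefinite program in the variables $Q\in\mathbb{S}^q$, $Y\in\mathbb{R}^{R\times q}$, $\gamma\in\mathbb{R}$: $$\nu(\Lambda)=\min_{Q\succ0,\,Y,\,\gamma}\ \gamma$$ subject to $$Y=\sum_{S\in N/\Lambda}\Pi'_SY\Pi_S,\qquad Q=\sum_{S\in N/\Lambda}\Pi_SQ\Pi_S,\qquad \begin{bmatrix}\gamma&x(0)^\top\\ x(0)&Q\end{bmatrix}\succeq0,$$ $$\begin{bmatrix}A_NQ+QA_N^\top+B_NY+Y^\top B_N^\top&(C_NQ+D_NY)^\top\\ C_NQ+D_NY&-I\end{bmatrix}\preceq0,$$ where $\Pi_S\in\mathbb{R}^{q\times q}$ (respectively, $\Pi'_S\in\mathbb{R}^{R\times R}$) denotes the block-diagonal projection matrix with identity blocks corresponding to the state dimensions $q_i$ (respectively, the input dimensions $r_i$), $i\in S$, and zeros elsewhere.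
   Context: Setting. $N$ is a finite set of agents. Agent $i\in N$ has state $x_i(t)\in\mathbb{R}^{q_i}$, control input $u_i(t)\in\mathbb{R}^{r_i}$ and dynamics $\dot x_i(t)=\sum_{j\in N}[A_{ij}x_j(t)+B_{ij}u_j(t)]$, with $A_{ij}\in\mathbb{R}^{q_i\times q_j}$, $B_{ij}\in\mathbb{R}^{q_i\times r_j}$. The output of agent $i$ is $z_i(t)=C_ix_i(t)+D_iu_i(t)$, where $D_i^\top D_i$ is regular (invertible) and $D_i^\top C_i=0$. Put $q=\sum_i q_i$, $R=\sum_i r_i$, $A_N=(A_{ij})_{i,j\in N}$, $B_N=(B_{ij})_{i,j\in N}$, $C_N=\mathrm{diag}(C_i)_{i\in N}$, $D_N=\mathrm{diag}(D_i)_{i\in N}$ (block diagonal), so the overall system is $\dot x_N=A_Nx_N+B_Nu_N$, $z_N=C_Nx_N+D_Nu_N$, with given initial state $x(0)\in\mathbb{R}^q$. The output energy is $J(u_N,x(0))=\int_0^\infty z_N(t)^\top z_N(t)\,dt$. Communication. $C$ is the edge set of the complete graph on $N$. For $\Lambda\subseteq C$, $N/\Lambda$ denotes the partition of $N$ into the vertex sets of the connected components of the graph $(N,\Lambda)$; two agents can coordinate their control if and only if they belong to the same component. Controllers are state feedbacks $u_N(t)=Kx_N(t)$, $K\in\mathbb{R}^{R\times q}$. A gain $K$ is adapted to the communication constraints of $\Lambda$ if $K=\sum_{S\in N/\Lambda}\Pi'_SK\Pi_S$, and a symmetric matrix $P$ is consistent with them if $P=\sum_{S\in N/\Lambda}\Pi_SP\Pi_S$.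 Standing assumption: for each $\Lambda$ there exist an adapted gain $K_\Lambda$ that stabilizes the overall system, and a quadratic Lyapunov function $f(\xi)=\xi^\top P_\Lambda\xi$ for the closed-loop system, consistent with the communication constraints, that provides an upper bound on the output energy. Definition of $\nu$. $\nu(\Lambda)$ is the smallest (infimal) value of $x(0)^\top Px(0)$ over all pairs $(K,P)$ with $K$ adapted to $\Lambda$, $P=P^\top\succ0$ consistent with $\Lambda$, and $$(A_N+B_NK)^\top P+P(A_N+B_NK)+(C_N+D_NK)^\top(C_N+D_NK)\preceq0.$$ Conventions. $\mathbb{S}^q$ is the space of real symmetric $q\times q$ matrices, $\succeq$ is the Löwner order, ''min'' denotes the optimal value. A TU game is a TU conic game if for each coalition $\Lambda$ there are (finite-dimensional) real vector spaces, a vector $b_\Lambda$, a linear functional $c_\Lambda$, a linear map $\mathcal{A}_\Lambda$ and a proper cone $\mathcal{K}_\Lambda$ (pointed, closed, convex, with nonempty interior) such that its value at $\Lambda$ is the optimal value of optimizing (max for profit games, min for cost games) $\langle c_\Lambda,x\rangle$ subject to $\mathcal{A}_\Lambda x=b_\Lambda$, $x\in\mathcal{K}_\Lambda$. A cost game is monotonic if $\Lambda\subseteq\Lambda'$ implies $\nu(\Lambda)\ge\nu(\Lambda')$. *)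

(* Defs.v *)
From HB Require Import structures.
From mathcomp Require Import all_boot all_order all_algebra.
From mathcomp Require Import all_classical all_reals all_analysis.

Set Implicit Arguments.
Unset Strict Implicit.
Unset Printing Implicit Defensive.

Import Order.TTheory GRing.Theory Num.Theory.
Import numFieldNormedType.Exports.

Local Open Scope classical_set_scope.
Local Open Scope ring_scope.

Definition monotonic_cost_game (R : realType) (T : finType)
    (v : {set T} -> R) : Prop :=
  forall L L' : {set T}, L \subset L' -> v L' <= v L.

Definition proper_cone (R : realType) (m : nat) (K : set 'cV[R]_m) : Prop :=
  [/\ forall (a : R) x, 0 <= a -> K x -> K (a *: x),
      convex_set K,
      closed K,
      interior K !=set0
    & forall x, K x -> K (- x) -> x = 0].

(** The infimum is taken in the extended reals, so that stating that it equals
    a real number entails feasibility and boundedness. *)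
Definition conic_min (R : realType) (m k : nat) (c : {scalar 'cV[R]_m})
    (A : {linear 'cV[R]_m -> 'cV[R]_k}) (b : 'cV[R]_k)
    (K : set 'cV[R]_m) : \bar R :=
  ereal_inf [set (c x)%:E | x in [set x | A x = b /\ K x]].

(** The finite-dimensional real vector spaces are taken in coordinates, which
    also supplies the topology used in [proper_cone]. *)
Definition tu_conic_cost_game (R : realType) (T : finType)
    (v : {set T} -> R) : Prop :=
  forall L : {set T}, exists (m k : nat) (c : {scalar 'cV[R]_m})
      (A : {linear 'cV[R]_m -> 'cV[R]_k}) (b : 'cV[R]_k) (K : set 'cV[R]_m),
    proper_cone K /\ (v L)%:E = conic_min c A b K.

(** The edges of the complete graph on ['I_n]: the two-element sets. *)
Definition edge (n : nat) := {e : {set 'I_n} | #|e| == 2}.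

Definition coalition_edge (n : nat) (L : {set edge n}) : rel 'I_n :=
  fun i j => [exists e in L, val e == [set i; j]%SET].

Definition components (n : nat) (L : {set edge n}) : {set {set 'I_n}} :=
  equivalence_partition (connect (coalition_edge L)) [set: 'I_n]%SET.

(** Loewner order: [psdmx M] is M >= 0, [pdmx M] is M > 0 and [nsdmx M] is
    M <= 0; symmetry is part of each predicate. *)
Definition psdmx (R : realType) (m : nat) (M : 'M[R]_m) : Prop :=
  M^T = M /\ forall x : 'cV[R]_m, 0 <= (x^T *m M *m x) 0 0.

Definition pdmx (R : realType) (m : nat) (M : 'M[R]_m) : Prop :=
  M^T = M /\ forall x : 'cV[R]_m, x != 0 -> 0 < (x^T *m M *m x) 0 0.

Definition nsdmx (R : realType) (m : nat) (M : 'M[R]_m) : Prop :=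
  psdmx (- M).

Record multi_agent_system (R : realType) (n : nat) := MultiAgentSystem {
  state_dim : 'I_n -> nat;
  input_dim : 'I_n -> nat;
  output_dim : 'I_n -> nat;
  dynA : forall i j, 'M[R]_(state_dim i, state_dim j);
  dynB : forall i j, 'M[R]_(state_dim i, input_dim j);
  outC : forall i, 'M[R]_(output_dim i, state_dim i);
  outD : forall i, 'M[R]_(output_dim i, input_dim i);
  outD_regular : forall i, (outD i)^T *m outD i \in unitmx;
  outD_outC : forall i, (outD i)^T *m outC i = 0
}.

(** Block-diagonal matrix with rectangular diagonal blocks; as in [\mxdiag],
    [conform_mx] only transports [M i] along the equality [i = j]. *)
Definition rect_mxdiag (R : realType) (n : nat) (p q : 'I_n -> nat)
    (M : forall i, 'M[R]_(p i, q i)) : 'M[R]_((\sum_i p i)%N, (\sum_i q i)%N) :=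
  \mxblock_(i, j) (if i == j then conform_mx (0 : 'M[R]_(p i, q j)) (M i) else 0).

Definition block_proj (R : realType) (n : nat) (d : 'I_n -> nat)
    (S : {set 'I_n}) : 'M[R]_(\sum_i d i)%N :=
  \mxdiag_i (if i \in S then 1%:M else 0 : 'M[R]_(d i)).

Section ControlScheme.
Variables (R : realType) (n : nat) (sys : multi_agent_system R n).

Definition total_state : nat := (\sum_i state_dim sys i)%N.
Definition total_input : nat := (\sum_i input_dim sys i)%N.
Definition total_output : nat := (\sum_i output_dim sys i)%N.

Definition A_N : 'M[R]_total_state := \mxblock_(i, j) dynA sys i j.
Definition B_N : 'M[R]_(total_state, total_input) :=
  \mxblock_(i, j) dynB sys i j.
Definition C_N : 'M[R]_(total_output, total_state) := rect_mxdiag (outC sys).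
Definition D_N : 'M[R]_(total_output, total_input) := rect_mxdiag (outD sys).

Definition Pi (S : {set 'I_n}) : 'M[R]_total_state :=
  block_proj R (state_dim sys) S.
Definition Pi' (S : {set 'I_n}) : 'M[R]_total_input :=
  block_proj R (input_dim sys) S.

Definition adapted_gain (L : {set edge n})
    (K : 'M[R]_(total_input, total_state)) : Prop :=
  K = \sum_(S in components L) Pi' S *m K *m Pi S.

Definition consistent (L : {set edge n}) (P : 'M[R]_total_state) : Prop :=
  P = \sum_(S in components L) Pi S *m P *m Pi S.

Definition stabilizing (K : 'M[R]_(total_input, total_state)) : Prop :=
  forall x : R -> 'cV[R]_total_state,
    (forall t : R, is_derive t (1 : R) x ((A_N + B_N *m K) *m x t)) ->
    x t @[t --> +oo] --> (0 : 'cV[R]_total_state).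

(** [xi |-> xi^T P xi] is a Lyapunov function for the closed loop whose decay
    rate dominates [z^T z], where [z = (C_N + D_N K) x]; integrating along
    trajectories bounds the output energy by [x(0)^T P x(0)]. *)
Definition energy_lyapunov (K : 'M[R]_(total_input, total_state))
    (P : 'M[R]_total_state) : Prop :=
  pdmx P /\
  nsdmx ((A_N + B_N *m K)^T *m P + P *m (A_N + B_N *m K)
         + (C_N + D_N *m K)^T *m (C_N + D_N *m K)).

Definition standing_assumption : Prop :=
  forall L : {set edge n},
    exists (K : 'M[R]_(total_input, total_state)) (P : 'M[R]_total_state),
      [/\ adapted_gain L K, stabilizing K, consistent L P
        & energy_lyapunov K P].

Variable x0 : 'cV[R]_total_state.

(** The set is bounded below by 0, and nonempty under [standing_assumption], so
    [inf] is the genuine infimum there. *)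
Definition nu (L : {set edge n}) : R :=
  inf [set v | exists (K : 'M[R]_(total_input, total_state))
      (P : 'M[R]_total_state),
    [/\ adapted_gain L K, consistent L P, energy_lyapunov K P
      & v = (x0^T *m P *m x0) 0 0]].

Definition sdp_feasible (L : {set edge n}) (Q : 'M[R]_total_state)
    (Y : 'M[R]_(total_input, total_state)) (g : R) : Prop :=
  [/\ pdmx Q,
      Y = \sum_(S in components L) Pi' S *m Y *m Pi S,
      Q = \sum_(S in components L) Pi S *m Q *m Pi S,
      psdmx (block_mx (g%:M : 'M[R]_1) x0^T x0 Q)
    & nsdmx (block_mx
        (A_N *m Q + Q *m A_N^T + B_N *m Y + Y^T *m B_N^T)
        (C_N *m Q + D_N *m Y)^T
        (C_N *m Q + D_N *m Y)
        (- 1%:M : 'M[R]_total_output))].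

Definition sdp_min (L : {set edge n}) : \bar R :=
  ereal_inf [set g%:E | g in
    [set g | exists (Q : 'M[R]_total_state)
       (Y : 'M[R]_(total_input, total_state)), sdp_feasible L Q Y g]].

End ControlScheme.

(* Main.v *)
Require Import Defs.
From HB Require Import structures.
From mathcomp Require Import all_boot all_order all_algebra.
From mathcomp Require Import all_classical all_reals all_analysis.

Set Implicit Arguments.
Unset Strict Implicit.
Unset Printing Implicit Defensive.

Import Order.TTheory GRing.Theory Num.Theory.
Import numFieldNormedType.Exports.

Local Open Scope ring_scope.

(** A matrix is adapted to (or consistent with) a set of edges exactly when its
    entries vanish between states and inputs of agents lying in different
    components ([localizedP]).  Adding edges merges components, so it relaxes
    this constraint; the infimum defining [nu] is then taken over a larger set
    of certified bounds, and monotonicity follows.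

    The semidefinite program is obtained from the change of variables
    [Q = P^-1], [Y = K P^-1].  It preserves locality: locality amounts to
    commuting with the coordinate projections onto the components
    ([localized_comm]), a property stable under products and inverses.
    Multiplying the Lyapunov inequality by [Q] on both sides turns it into
    [A Q + Q A^T + B Y + Y^T B^T + (C Q + D Y)^T (C Q + D Y) <= 0]
    ([nsdmx_dissipation]), whose Schur complement form is the second block
    inequality of the program, while the Schur complement of the first one says
    that [x0^T P x0 <= gamma] ([psdmx_schur] covers both).  Hence every
    certified bound is a feasible [gamma], every feasible [gamma] is at least
    some certified bound, and the two infima agree.  The standing assumption
    makes both sets nonempty, and [0] bounds both from below, so the infimum in
    the reals and the one in the extended reals coincide.

    Being a conic game only requires, for each coalition separately, some conic
    program whose optimal value is the value of the coalition.  For a real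
    valued game a one-dimensional program over the nonnegative half-line
    suffices ([tu_conic_cost_game_real]). *)

(** * Comparison of infima *)

Lemma inf_le_dominated (R : realType) (A B : set R) :
  has_lbound A -> (B !=set0)%classic ->
  (forall b, B b -> exists2 a, A a & a <= b) -> inf A <= inf B.
Proof.
move=> lbA B0 AB; apply: lb_le_inf => // b /AB[a Aa]; apply: le_trans.
exact: ge_inf.
Qed.

(** * Semidefinite matrices and Schur complements *)

Section SemidefiniteMatrices.
Variable R : realType.

Lemma scalar_trmx_eq (M : 'M[R]_1) : M^T = M.
Proof. by rewrite [M]mx11_scalar tr_scalar_mx. Qed.

Lemma psdmx_congr m p (M : 'M[R]_m) (T : 'M[R]_(m, p)) :
  psdmx M -> psdmx (T^T *m M *m T).
Proof.
move=> [Msym Mge]; split=> [|x]; first by rewrite !trmx_mul trmxK Msym mulmxA.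
by rewrite !mulmxA -trmx_mul -!mulmxA mulmxA Mge.
Qed.

Lemma nsdmx_congr m p (M : 'M[R]_m) (T : 'M[R]_(m, p)) :
  nsdmx M -> nsdmx (T^T *m M *m T).
Proof. by move=> /(psdmx_congr T); rewrite /nsdmx mulmxN mulNmx. Qed.

Lemma pdmx_psdmx m (M : 'M[R]_m) : pdmx M -> psdmx M.
Proof.
move=> [Msym Mgt]; split=> // x; have [->|/Mgt/ltW//] := eqVneq x 0.
by rewrite mulmx0 mxE.
Qed.

Lemma pdmx_unit m (M : 'M[R]_m) : pdmx M -> M \in unitmx.
Proof.
move=> [Msym Mgt]; rewrite -row_free_unit -kermx_eq0; apply/rowV0P => v.
rewrite sub_kermx => /eqP vM0; apply/eqP; apply/negPn/negP => v0.
have /Mgt : v^T != 0 by rewrite trmx_eq0.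
by rewrite trmxK vM0 mul0mx mxE ltxx.
Qed.

Lemma pdmx_inv m (M : 'M[R]_m) : pdmx M -> pdmx (invmx M).
Proof.
move=> Mpd; have Mu := pdmx_unit Mpd; have [Msym Mgt] := Mpd.
have Vsym : (invmx M)^T = invmx M by rewrite trmx_inv Msym.
split=> // x x0; have -> : x^T *m invmx M *m x =
    (invmx M *m x)^T *m M *m (invmx M *m x).
  by rewrite trmx_mul Vsym !mulmxA mulmxKV.
by apply: Mgt; apply: contra x0 => /eqP Vx0; rewrite -[x](mulKVmx Mu) Vx0 mulmx0.
Qed.

Lemma psdmx_schur m p (A : 'M[R]_m) (B : 'M[R]_(p, m)) (D : 'M[R]_p) :
  pdmx D ->
  psdmx (block_mx A B^T B D) <-> psdmx (A - B^T *m invmx D *m B).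
Proof.
move=> Dpd; have Du := pdmx_unit Dpd; have [Dsym _] := Dpd.
have [Vsym _] := pdmx_inv Dpd.
(* Completion of the square in [v]. *)
have sqE (u : 'cV[R]_m) (v : 'cV[R]_p) :
    (col_mx u v)^T *m block_mx A B^T B D *m col_mx u v =
    u^T *m (A - B^T *m invmx D *m B) *m u
    + (v + invmx D *m (B *m u))^T *m D *m (v + invmx D *m (B *m u)).
  rewrite tr_col_mx mul_row_block mul_row_col.
  rewrite [(v + _)^T]linearD /= !trmx_mul Vsym !(mulmxDl, mulmxDr, mulmxBl, mulmxBr).
  rewrite !mulmxA !(mulmxKV Du) !(mulmxK Du) ?(mulmxKV Du).
  by rewrite mulmxN mulNmx !mulmxA !addrA [RHS](ACl (1*5*4*3*2*6))/= subrK.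
split=> [[Ssym Sge]|[Ssym Sge]].
  have Asym : A^T = A.
    by move: Ssym; rewrite tr_block_mx trmxK => /eq_block_mx[].
  split=> [|x]; first by rewrite linearB /= !trmx_mul trmxK Vsym Asym mulmxA.
  (* The second block is chosen so that the completed square vanishes. *)
  have := Sge (col_mx x (- (invmx D *m (B *m x)))).
  by rewrite sqE addNr mulmx0 addr0.
have Asym : A^T = A.
  by move: Ssym; rewrite linearB /= !trmx_mul trmxK Vsym mulmxA => /addIr.
split=> [|x]; first by rewrite tr_block_mx trmxK Asym Dsym.
rewrite -[x]vsubmxK sqE mxE addr_ge0 //.
by have [_] := pdmx_psdmx Dpd; apply.
Qed.

(** The Schur complement of a block [- 1%:M], for negative semidefiniteness. *)
Lemma nsdmx_schur1 m p (A : 'M[R]_m) (B : 'M[R]_(p, m)) :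
  nsdmx (block_mx A B^T B (- 1%:M)) <-> nsdmx (A + B^T *m B).
Proof.
have Ipd : pdmx (1%:M : 'M[R]_p).
  split=> [|x x0]; first exact: tr_scalar_mx.
  have sq_ge0 i : true -> 0 <= x^T 0 i * x i 0.
    by rewrite mxE -expr2 sqr_ge0.
  rewrite mulmx1 mxE lt_neqAle sumr_ge0 // andbT eq_sym.
  apply: contra x0 => /eqP/(psumr_eq0P sq_ge0) sq0.
  apply/eqP/colP => i; have /eqP := sq0 i isT.
  by rewrite !mxE mulf_eq0 orbb => /eqP.
have trN : - B^T = (- B)^T by rewrite linearN.
rewrite /nsdmx opp_block_mx opprK trN (psdmx_schur _ _ Ipd) -trN.
by rewrite invmx1 mulmx1 mulmxN mulNmx opprK opprD.
Qed.

Lemma psdmx_scalar1 (M : 'M[R]_1) : psdmx M <-> 0 <= M 0 0.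
Proof.
split=> [[_ /(_ 1%:M)]|M0]; first by rewrite mulmx1 trmx1 mul1mx.
split=> [|x]; first exact: scalar_trmx_eq.
rewrite [x]mx11_scalar tr_scalar_mx mul_scalar_mx mul_mx_scalar !mxE.
by rewrite mulrA -expr2 mulr_ge0 ?sqr_ge0.
Qed.

(** The epigraph of [x |-> x^T Q^-1 x] as a linear matrix inequality. *)
Lemma psdmx_epigraph p (g : R) (x : 'cV[R]_p) (Q : 'M[R]_p) :
  pdmx Q ->
  psdmx (block_mx (g%:M : 'M[R]_1) x^T x Q) <->
  (x^T *m invmx Q *m x) 0 0 <= g.
Proof.
move=> Qpd; rewrite psdmx_schur // psdmx_scalar1.
by rewrite !mxE eqxx mulr1n subr_ge0.
Qed.

End SemidefiniteMatrices.

(** * Components of a communication graph *)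

Section Components.
Variable n : nat.
Implicit Types (L : {set edge n}) (i j : 'I_n).

(** The agents [i] and [j] are joined by a path of edges of [L]. *)
Definition linked L : rel 'I_n := connect (coalition_edge L).

Lemma linked_sym L : connect_sym (coalition_edge L).
Proof. by apply: sym_connect_sym => a b; rewrite /coalition_edge finset.setUC. Qed.

Lemma linked_equiv L : equivalence_rel (linked L).
Proof.
apply/equivalence_relP; split; first exact: connect0.
move=> i j ij k; apply: (same_connect _ ij).
exact: linked_sym.
Qed.

Lemma linkedS L L' i j : L \subset L' -> linked L i j -> linked L' i j.
Proof.
move=> /fintype.subsetP LL'; apply: connect_sub => a b /exists_inP[e eL eab].
by apply/connect1/exists_inP; exists e => //; exact: LL'.
Qed.

(** The vertex set of the connected component of [i]. *)
Definition component L i : {set 'I_n} := [set j | linked L i j]%SET.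

Lemma in_component L i j : (j \in component L i) = linked L i j.
Proof. by rewrite inE. Qed.

Lemma in_components L i j (S : {set 'I_n}) : S \in components L ->
  i \in S -> (j \in S) = linked L i j.
Proof.
move=> /imsetP[k _ ->]; rewrite !inE /= => ki.
by rewrite -/(linked L); apply: ((equivalence_relP _).1 (linked_equiv L)).2.
Qed.

(** Exactly one component contains [i]. *)
Lemma sum_components (V : nmodType) L i (f : {set 'I_n} -> V) :
  \sum_(S in components L | i \in S) f S = f (component L i).
Proof.
rewrite (big_pred1 (component L i)) // => S.
apply/andP/eqP=> [[SL iS]|->].
  by apply/setP=> j; rewrite inE (in_components j SL iS).
split; last by rewrite inE; exact: connect0.
by apply/imsetP; exists i => //; apply/setP=> j; rewrite !inE.
Qed.

End Components.

(** * Matrices respecting the components *)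

Section Localized.
Variables (R : realType) (n : nat).
Implicit Types (L : {set edge n}) (d : 'I_n -> nat).

Lemma block_projE d S :
  block_proj R d S = diag_mx (\row_k (tagnat.sig1 k \in S)%:R).
Proof.
transitivity (diag_mx (\mxrow_i (const_mx (i \in S)%:R : 'rV[R]_(d i)))).
  rewrite diag_mxrow; apply: eq_mxdiag => i; rewrite diag_const_mx.
  by case: (i \in S); rewrite // raddf0.
by congr diag_mx; apply/rowP => k; rewrite !mxE.
Qed.

(** The entries of [K] between unlinked agents vanish; [tagnat.sig1] maps a
    coordinate of the stacked vector to the agent that owns it. *)
Definition localized d' d L (K : 'M[R]_(\sum_i d' i, \sum_i d i)) :=
  forall a b, ~~ linked L (tagnat.sig1 a) (tagnat.sig1 b) -> K a b = 0.

(** The common content of [adapted_gain] and [consistent], which are the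
    instances for (input, state) and (state, state) dimensions. *)
Lemma localizedP d' d L (K : 'M[R]_(\sum_i d' i, \sum_i d i)) :
  K = \sum_(S in components L) block_proj R d' S *m K *m block_proj R d S <->
  localized L K.
Proof.
have sumE a b : (\sum_(S in components L)
    block_proj R d' S *m K *m block_proj R d S) a b =
    (linked L (tagnat.sig1 a) (tagnat.sig1 b))%:R * K a b.
  rewrite summxE -in_component.
  rewrite -(sum_components L (tagnat.sig1 a)
              (fun S : {set 'I_n} => (tagnat.sig1 b \in S)%:R * K a b)).
  rewrite big_mkcondr /=; apply: eq_bigr => S _.
  rewrite !block_projE mul_mx_diag mul_diag_mx !mxE mulrC.
  by case: (tagnat.sig1 a \in S); rewrite ?mul1r ?mul0r ?mulr0.
split=> [-> a b /negbTE ab|Kloc]; first by rewrite sumE ab mul0r.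
apply/matrixP=> a b; rewrite sumE.
by have [_|/Kloc->] := boolP (linked L _ _); rewrite ?mul1r ?mulr0.
Qed.

(** For square [K] this is commutation with the projections onto the
    components, which makes stability under inversion immediate. *)
Lemma localized_comm d' d L (K : 'M[R]_(\sum_i d' i, \sum_i d i)) :
  localized L K <->
  forall i, block_proj R d' (component L i) *m K =
            K *m block_proj R d (component L i).
Proof.
split=> [Kloc i|Kcomm a b /negbTE ab].
  apply/matrixP=> a b; rewrite !block_projE mul_mx_diag mul_diag_mx !mxE !inE.
  have [ab|/Kloc->] := boolP (linked L (tagnat.sig1 a) (tagnat.sig1 b)); last first.
    by rewrite mulr0 mul0r.
  suff -> : linked L i (tagnat.sig1 a) = linked L i (tagnat.sig1 b).
    by rewrite mulrC.
  exact: (same_connect_r (linked_sym L) ab).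
have /matrixP/(_ a b) := Kcomm (tagnat.sig1 a).
rewrite !block_projE mul_mx_diag mul_diag_mx !mxE !inE ab.
by rewrite [linked _ _ _]connect0 mul1r mulr0.
Qed.

Lemma localized_mulmx d1 d2 d3 L (K : 'M[R]_(\sum_i d1 i, \sum_i d2 i))
    (P : 'M[R]_(\sum_i d2 i, \sum_i d3 i)) :
  localized L K -> localized L P -> localized L (K *m P).
Proof.
move=> /localized_comm Kc /localized_comm Pc; apply/localized_comm => i.
by rewrite mulmxA Kc -mulmxA Pc mulmxA.
Qed.

Lemma localized_inv d L (P : 'M[R]_(\sum_i d i)) :
  P \in unitmx -> localized L P -> localized L (invmx P).
Proof.
move=> Pu /localized_comm Pc; apply/localized_comm => i.
by apply: (can_inj (mulKmx Pu)); rewrite mulKVmx // mulmxA -Pc mulmxK.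
Qed.

Lemma localizedS d' d L L' (K : 'M[R]_(\sum_i d' i, \sum_i d i)) :
  L \subset L' -> localized L K -> localized L' K.
Proof.
by move=> LL' Kloc a b ab; apply: Kloc; apply: contra ab; exact: linkedS.
Qed.
End Localized.

(** * Conic representation *)

(** The definition of a conic game puts no condition relating the programs of
    different coalitions, nor relating their data to those of the game: the
    value [v L] is the minimum of [v L * x] subject to [x = 1] and [x >= 0]. *)
Lemma tu_conic_cost_game_real (R : realType) (T : finType)
    (v : {set T} -> R) : tu_conic_cost_game v.
Proof.
move=> L; exists 1%N, 1%N.
pose c (x : 'cV[R]_1) := v L * x 0 0.
have c_lin : scalar c by move=> a x y; rewrite /c !mxE mulrDr mulrCA.
exists (HB.pack_for {scalar 'cV[R]_1} c (GRing.isLinear.Build _ _ _ _ _ c_lin)).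
exists (idfun : {linear 'cV[R]_1 -> 'cV[R]_1}), (const_mx 1).
exists [set x : 'cV[R]_1 | 0 <= x 0 0]%classic.
have K_cont := @coord_continuous R 1 1 0 0.
split.
  split=> /=.
  - by move=> a x a0 x0; rewrite mxE mulr_ge0.
  - move=> x y t; rewrite !inE /= => x0 y0.
    by rewrite !mxE addr_ge0 ?mulr_ge0 // subr_ge0.
  - exact: ((continuous_closedP _).1 K_cont _ (@closed_ge R 0)).
  - exists (const_mx 1); rewrite /interior /=.
    have pos1 : 0 < (const_mx 1 : 'cV[R]_1) 0 0 by rewrite mxE.
    have near1 : \forall x \near (const_mx 1 : 'cV[R]_1), 0 < (x : 'cV[R]_1) 0 0.
      exact: (K_cont _ _ (lt_nbhsr pos1)).
    by apply: filterS near1 => x /=; exact: ltW.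
  - move=> x x0; rewrite mxE oppr_ge0 => x0'.
    by apply/matrixP => i j; rewrite !ord1 mxE; apply/eqP; rewrite eq_le x0 x0'.
rewrite /conic_min.
have -> : [set x : 'cV[R]_1 | idfun x = const_mx 1 /\ 0 <= x 0 0]%classic =
    [set const_mx 1]%classic.
  apply/seteqP; split => [x /= [] //|x /= ->].
  by split=> //; rewrite mxE.
by rewrite image_set1 ereal_inf1 /= /c mxE mulr1.
Qed.

(** * The Lyapunov inequality in primal and dual variables *)

Section Certificates.
Variables (R : realType) (q r p : nat).
Variables (A : 'M[R]_q) (B : 'M[R]_(q, r)) (C : 'M[R]_(p, q)) (D : 'M[R]_(p, r)).

(** The matrix of the quadratic form giving the derivative of [x^T P x] along
    the closed loop of gain [K], plus the output power. *)
Definition dissipation (K : 'M[R]_(r, q)) (P : 'M[R]_q) : 'M[R]_q :=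
  (A + B *m K)^T *m P + P *m (A + B *m K) + (C + D *m K)^T *m (C + D *m K).

(** The same matrix in the variables [Q = P^-1] and [Y = K Q], up to
    congruence by [Q]. *)
Definition dual_dissipation (Q : 'M[R]_q) (Y : 'M[R]_(r, q)) : 'M[R]_q :=
  A *m Q + Q *m A^T + B *m Y + Y^T *m B^T
  + (C *m Q + D *m Y)^T *m (C *m Q + D *m Y).

Lemma dissipation_congr (K : 'M[R]_(r, q)) (P Q : 'M[R]_q) :
  Q^T = Q -> P *m Q = 1%:M ->
  Q^T *m dissipation K P *m Q = dual_dissipation Q (K *m Q).
Proof.
move=> Qsym PQ; have QP : Q *m P = 1%:M by apply: mulmx1C.
have clE : (A + B *m K) *m Q = A *m Q + B *m (K *m Q).
  by rewrite mulmxDl mulmxA.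
have outE : (C + D *m K) *m Q = C *m Q + D *m (K *m Q).
  by rewrite mulmxDl mulmxA.
rewrite /dissipation /dual_dissipation -outE.
rewrite [Q^T *m _]mulmxDr [LHS]mulmxDl [Q^T *m (_ *m P + _)]mulmxDr.
rewrite [(_ + _) *m Q in LHS]mulmxDl.
congr (_ + _); last by rewrite trmx_mul !mulmxA.
transitivity (((A + B *m K) *m Q)^T + (A + B *m K) *m Q).
  congr (_ + _); first by rewrite trmx_mul -!mulmxA PQ mulmx1.
  by rewrite Qsym mulmxA QP mul1mx.
rewrite clE linearD /= !trmx_mul Qsym.
by rewrite !mulmxA !addrA [LHS](ACl (3*1*4*2)).
Qed.

Lemma nsdmx_dissipation (K : 'M[R]_(r, q)) (P Q : 'M[R]_q) :
  Q^T = Q -> P *m Q = 1%:M ->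
  nsdmx (dissipation K P) <-> nsdmx (dual_dissipation Q (K *m Q)).
Proof.
move=> Qsym PQ; rewrite -(dissipation_congr K Qsym PQ).
split=> [|h]; first exact: nsdmx_congr.
have <- : P^T *m (Q^T *m dissipation K P *m Q) *m P = dissipation K P.
  rewrite !mulmxA -trmx_mul -mulmxA (mulmx1C PQ) trmx1 mul1mx.
  by rewrite mulmx1.
exact: nsdmx_congr.
Qed.

End Certificates.

(** * Certified energy bounds and the semidefinite program *)

Section EnergyBounds.
Variables (R : realType) (n : nat) (sys : multi_agent_system R n).
Variable x0 : 'cV[R]_(total_state sys).
Implicit Type L : {set edge n}.

(** The energy bounds whose infimum is [nu x0 L]. *)
Definition certified_bounds L : set R :=
  [set v | exists (K : 'M[R]_(total_input sys, total_state sys))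
      (P : 'M[R]_(total_state sys)),
    [/\ adapted_gain L K, consistent L P, energy_lyapunov K P
      & v = (x0^T *m P *m x0) 0 0]]%classic.

(** The objective values whose infimum is [sdp_min x0 L]. *)
Definition sdp_values L : set R :=
  [set g | exists (Q : 'M[R]_(total_state sys))
      (Y : 'M[R]_(total_input sys, total_state sys)),
    sdp_feasible x0 L Q Y g]%classic.

(** Feasibility with both block inequalities replaced by their Schur
    complements. *)
Lemma sdp_feasibleE L Q Y g : sdp_feasible x0 L Q Y g <->
  [/\ pdmx Q, localized L Y, localized L Q,
      (x0^T *m invmx Q *m x0) 0 0 <= g
    & nsdmx (dual_dissipation (A_N sys) (B_N sys) (C_N sys) (D_N sys) Q Y)].
Proof.
split=> [[Qpd /localizedP Yl /localizedP Ql /psdmx_epigraph xg /nsdmx_schur1 h]|].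
  by split=> //; exact: xg.
move=> [Qpd Yl Ql xg h]; split=> //; [exact/localizedP|exact/localizedP| |].
  exact/psdmx_epigraph.
exact/nsdmx_schur1.
Qed.

Lemma certified_bounds_sdp L v : certified_bounds L v -> sdp_values L v.
Proof.
move=> [K [P [/localizedP Kl /localizedP Pl [Ppd Pdis] ->]]].
have Pu := pdmx_unit Ppd; have Qpd := pdmx_inv Ppd.
have Ql := localized_inv Pu Pl.
exists (invmx P), (K *m invmx P); apply/sdp_feasibleE; split=> //.
- exact: localized_mulmx Kl Ql.
- by rewrite invmxK.
- apply/nsdmx_dissipation; last exact: Pdis; first by case: Qpd.
  exact: mulmxV.
Qed.

Lemma sdp_certified_bounds L g :
  sdp_values L g -> exists2 v, certified_bounds L v & v <= g.
Proof.
move=> [Q [Y /sdp_feasibleE[Qpd Yl Ql xg Qdis]]].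
have Qu := pdmx_unit Qpd; have Pl := localized_inv Qu Ql.
exists ((x0^T *m invmx Q *m x0) 0 0) => //.
exists (Y *m invmx Q), (invmx Q); split=> //.
- by apply/localizedP; exact: localized_mulmx Yl Pl.
- exact/localizedP.
- split; first exact: pdmx_inv.
  apply/(nsdmx_dissipation _ _ _ _ (Y *m invmx Q) (Q := Q)).
  + by case: Qpd.
  + exact: mulVmx.
  + by rewrite mulmxKV.
Qed.

Lemma certified_bounds_ge0 L : lbound (certified_bounds L) 0.
Proof. by move=> _ [K [P [_ _ [/pdmx_psdmx[_ Pge] _] ->]]]; exact: Pge. Qed.

Lemma sdp_values_ge0 L : lbound (sdp_values L) 0.
Proof.
by move=> g /sdp_certified_bounds[v /certified_bounds_ge0]; exact: le_trans.
Qed.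

Lemma certified_bounds_neq0 L :
  standing_assumption sys -> (certified_bounds L !=set0)%classic.
Proof.
move=> /(_ L)[K [P [Ka _ Pc KP]]].
by exists ((x0^T *m P *m x0) 0 0), K, P.
Qed.

Lemma certified_boundsS L L' : L \subset L' ->
  (certified_bounds L `<=` certified_bounds L')%classic.
Proof.
move=> LL' v [K [P [/localizedP Kl /localizedP Pl KP ->]]].
by exists K, P; split=> //; apply/localizedP; exact: localizedS LL' _.
Qed.

End EnergyBounds.

Theorem theorem5 (R : realType) (n : nat) (sys : multi_agent_system R n)
    (x0 : 'cV[R]_(total_state sys)) :
  standing_assumption sys ->
  [/\ monotonic_cost_game (nu x0),
      tu_conic_cost_game (nu x0)
    & forall L : {set edge n}, (nu x0 L)%:E = sdp_min x0 L].
Proof.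
move=> standing.
have bounds0 L := certified_bounds_neq0 x0 L standing.
have bounds_lb L : has_lbound (certified_bounds x0 L).
  by exists 0; exact: certified_bounds_ge0.
have sdp_lb L : has_lbound (sdp_values x0 L).
  by exists 0; exact: sdp_values_ge0.
have sdp0 L : (sdp_values x0 L !=set0)%classic.
  by have [v /certified_bounds_sdp] := bounds0 L; exists v.
split=> [L L' LL'||L].
- apply: inf_le_dominated => [||v Lv]; [exact: bounds_lb|exact: bounds0|].
  by exists v => //; exact: certified_boundsS LL' _ Lv.
- exact: tu_conic_cost_game_real.
- rewrite [RHS](ereal_inf_EFin (sdp_lb L) (sdp0 L)); congr EFin.
  apply/eqP; rewrite eq_le; apply/andP; split; apply: inf_le_dominated.
  + exact: bounds_lb.
  + exact: sdp0.
  + by move=> g; exact: sdp_certified_bounds.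
  + exact: sdp_lb.
  + exact: bounds0.
  + by move=> v Lv; exists v => //; exact: certified_bounds_sdp.
Qed.
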